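(* Let $M$ be an irreducible affine algebraic monoid over an algebraically closed field $\Bbbk$, with unit group $G$, and let $H\subset G$ be a normal subgroup that is closed in $M$. Then there exists a determinant $\chi:M\to\Bbbk$ such that $H\subseteq\ker(\chi)$, i.e. $\chi(h)=1$ for all $h\in H$.
   Context: An algebraic monoid is an algebraic variety $M$ with an associative product $M\times M\to M$ that is a morphism of varieties and has a neutral element $1$. Its unit group $G=G(M)$ is an algebraic group, open in $M$. A determinant of an irreducible affine algebraic monoid $M$ is a morphism of algebraic monoids $\chi:M\to\Bbbk$ (with $\Bbbk$ under multiplication, so $\chi(ab)=\chi(a)\chi(b)$ and $\chi(1)=1$) such that $\chi^{-1}(0)=M\setminus G$. Here $\ker(\chi)=\chi^{-1}(1)$. *)

(* Defs.v *)
(* Classical affine varieties: Zariski closed subsets of k^n, with points in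
   'rV[k]_n, over MathComp and multinomials. *)
From HB Require Import structures.
From mathcomp Require Import all_boot all_order all_algebra.
From mathcomp Require Import mpoly.

Set Implicit Arguments.
Unset Strict Implicit.
Unset Printing Implicit Defensive.

Import GRing.Theory.
Local Open Scope ring_scope.

Section Varieties.
Variable k : closedFieldType.

Definition zariski_closed (n : nat) (V : 'rV[k]_n -> Prop) : Prop :=
  exists S : {mpoly k[n]} -> Prop,
    forall x, V x <-> (forall p, S p -> p.@[x ord0] = 0).

Definition closed_in (n : nat) (X Z : 'rV[k]_n -> Prop) : Prop :=
  exists2 A : 'rV[k]_n -> Prop,
    zariski_closed A & forall x, Z x <-> X x /\ A x.

Definition irreducible_variety (n : nat) (X : 'rV[k]_n -> Prop) : Prop :=
  (exists x, X x) /\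
  (forall A B : 'rV[k]_n -> Prop,
     closed_in X A -> closed_in X B ->
     (forall x, X x -> A x \/ B x) ->
     (forall x, X x -> A x) \/ (forall x, X x -> B x)).

(* Functions on X are given as total functions on the ambient affine space;
   only their values on X are ever constrained. *)
Definition regular_function (n : nat) (X : 'rV[k]_n -> Prop)
    (f : 'rV[k]_n -> k) : Prop :=
  exists p : {mpoly k[n]}, forall x, X x -> f x = p.@[x ord0].

Definition variety_morphism (n m : nat) (X : 'rV[k]_n -> Prop)
    (Y : 'rV[k]_m -> Prop) (f : 'rV[k]_n -> 'rV[k]_m) : Prop :=
  (forall x, X x -> Y (f x)) /\
  (forall j : 'I_m, regular_function X (fun x => f x ord0 j)).

Definition variety_product (n m : nat) (X : 'rV[k]_n -> Prop)
    (Y : 'rV[k]_m -> Prop) : 'rV[k]_(n + m) -> Prop :=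
  fun z => X (lsubmx z) /\ Y (rsubmx z).

Record affineMonoid : Type := AffineMonoid {
  mdim : nat;
  points :> 'rV[k]_mdim -> Prop;
  mmul : 'rV[k]_mdim -> 'rV[k]_mdim -> 'rV[k]_mdim;
  mone : 'rV[k]_mdim;
  points_closed : zariski_closed points;
  mmul_morphism :
    variety_morphism (variety_product points points) points
      (fun z => mmul (lsubmx z) (rsubmx z));
  mone_points : points mone;
  mmulA : forall x y z, points x -> points y -> points z ->
    mmul x (mmul y z) = mmul (mmul x y) z;
  mmul1x : forall x, points x -> mmul mone x = x;
  mmulx1 : forall x, points x -> mmul x mone = x
}.

Definition inverse_of (M : affineMonoid) (x y : 'rV[k]_(mdim M)) : Prop :=
  mmul x y = mone M /\ mmul y x = mone M.

Definition unit_group (M : affineMonoid) (x : 'rV[k]_(mdim M)) : Prop :=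
  M x /\ exists2 y, M y & inverse_of x y.

Definition normal_subgroup (M : affineMonoid) (H : 'rV[k]_(mdim M) -> Prop) :
    Prop :=
  [/\ forall x, H x -> unit_group x,
      H (mone M),
      forall x y, H x -> H y -> H (mmul x y),
      forall x y, H x -> M y -> inverse_of x y -> H y
    & forall g g' h, M g -> M g' -> inverse_of g g' -> H h ->
        H (mmul (mmul g h) g')].

(* Morphisms from M to the affine line are the regular functions on M. *)
Definition monoid_determinant (M : affineMonoid)
    (chi : 'rV[k]_(mdim M) -> k) : Prop :=
  [/\ regular_function M chi,
      chi (mone M) = 1,
      forall x y, M x -> M y -> chi (mmul x y) = chi x * chi y
    & forall x, M x -> (chi x = 0 <-> ~ unit_group x)].

End Varieties.

(* Main.v *)
Require Import Defs.
From HB Require Import structures.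
From Stdlib Require Import Classical.
From mathcomp Require Import all_boot all_order all_algebra.
From mathcomp Require Import mpoly.

(* Left translations make a finite dimensional space V of regular functions on M
   a representation of M. Applied to the coordinates this embeds M in a matrix
   monoid and gives a determinant d, but d need not be 1 on H. As H is closed in
   M and d has no zero on H, the Nullstellensatz gives u with u d = 1 on H. Take
   for V the left translates of f = u d together with the other functions in a
   stable space of multiples of d: the nonunits of M act by 0 on V, and modulo
   the functions which vanish on H, the vector f is fixed by H. So the trivial
   representation of H is a subquotient of V. Since H is normal in G, Clifford's
   theorem yields G-stable subspaces B < A of V such that H acts trivially on
   A/B, and the determinant of the action of M on A/B is the required chi. *)

Set Implicit Arguments.
Unset Strict Implicit.
Unset Printing Implicit Defensive.

Import GRing.Theory.
Local Open Scope ring_scope.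

(** * Dual bases of spaces of functions *)

(** A maximality principle: if [P] passed from every [r] to [r.+1], it would reach [D.+1], beyond
    the bound. *)
Lemma last_index_ex (P : nat -> Prop) (D : nat) :
  P 0%N -> (forall r, P r -> (r <= D)%N) -> exists2 r, P r & ~ P r.+1.
Proof.
move=> P0 PD; apply: NNPP => nP.
have Pall r : P r.
  by elim: r => // r IH; apply: NNPP => nPS; apply: nP; exists r.
by have := PD _ (Pall D.+1); rewrite ltnn.
Qed.

(** A family in [S] dual to points of [X] and of maximal length is a basis: an [f] that differs
    somewhere from its interpolation would yield a longer family. *)
Lemma dual_basis (k : fieldType) (T : Type) (X : T -> Prop)
    (S : (T -> k) -> Prop) (I : finType) (m : I -> T -> k) :
    (forall f g, (forall x, X x -> f x = g x) -> S f -> S g) ->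
    S (fun=> 0) ->
    (forall c f g, S f -> S g -> S (fun x => f x + c * g x)) ->
    (forall f, S f -> exists e : I -> k,
       forall x, X x -> f x = \sum_i e i * m i x) ->
  exists (r : nat) (w : 'I_r -> T -> k) (p : 'I_r -> T),
    [/\ forall i, S (w i), forall i, X (p i),
        forall i j, w i (p j) = (i == j)%:R
      & forall f, S f -> forall x, X x -> f x = \sum_i f (p i) * w i x].
Proof.
move=> Sext S0 SD Sm.
pose P r := exists (w : 'I_r -> T -> k) (p : 'I_r -> T),
  [/\ forall i, S (w i), forall i, X (p i) &
      forall i j, w i (p j) = (i == j)%:R].
have P0 : P 0%N.
  exists (fun _ _ => 0), (fun i : 'I_0 => False_rect T (notF (ltn_ord i))).
  by split; case.
have PD r : P r -> (r <= #|I|)%N.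
  case=> w [p [Sw Xp wp]].
  have [e we] : exists e : 'I_r -> I -> k,
      forall i x, X x -> w i x = \sum_j e i j * m j x.
    by apply: (fin_all_exists (fun i => Sm _ (Sw i))).
  have I1 : (\matrix_(i, l) e i (@enum_val I predT l)) *m
      (\matrix_(l, j) m (@enum_val I predT l) (p j)) = 1%:M.
    apply/matrixP=> i j; rewrite !mxE -wp we //.
    rewrite (reindex (@enum_val I predT)) /=; last exact/onW_bij/enum_val_bij.
    by apply: eq_bigr => l _; rewrite !mxE.
  rewrite -(mxrank1 k r) -I1.
  by apply: leq_trans (mxrankM_maxl _ _) (rank_leq_col _).
have Ssum r (c : 'I_r -> k) (w : 'I_r -> T -> k) f : S f ->
    (forall i, S (w i)) -> S (fun x => f x + \sum_i c i * w i x).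
  move=> Sf Sw.
  elim: (index_enum _) => [|i s IH].
    by apply: Sext Sf => x _; rewrite big_nil addr0.
  apply: Sext (SD (c i) _ _ IH (Sw i)) => x _.
  by rewrite big_cons addrAC -addrA.
have [r [w [p [Sw Xp wp]]] nPS] := last_index_ex P0 PD.
exists r, w, p; split=> // f Sf x Xx; apply: NNPP => neq; apply: nPS.
(* The interpolation error vanishes at every [p j] but not at [x]. Rescaled, it becomes the function
   dual to [x], and each [w j] is corrected so as to vanish at [x]. *)
pose g y := f y + \sum_i (- f (p i)) * w i y.
have Sg : S g by apply: Ssum.
have gx : g x != 0.
  rewrite /g; under eq_bigr do rewrite mulNr.
  by rewrite sumrN subr_eq0; apply/eqP.
have gp j : g (p j) = 0.
  rewrite /g (bigD1 j) //= wp eqxx mulr1 big1 => [|i /negPf ij].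
    by rewrite addr0 subrr.
  by rewrite wp ij mulr0.
pose w0 y := (g x)^-1 * g y.
have Sw0 : S w0 by apply: Sext (SD (g x)^-1 _ _ S0 Sg) => y _; rewrite add0r.
exists (fun i => if unlift ord0 i is Some j
   then fun y => w j y + (- w j x) * w0 y else w0).
exists (fun i => if unlift ord0 i is Some j then p j else x).
split=> [i|i|i j].
- by case: unliftP => [j _|_] //; apply: SD.
- by case: unliftP.
case: unliftP => [i' ->|->]; case: unliftP => [j' ->|->].
- by rewrite /w0 gp !mulr0 addr0 wp (inj_eq lift_inj).
- by rewrite /w0 mulVf // mulr1 subrr eq_sym -[_ == _]negbK neq_lift.
- by rewrite /w0 gp mulr0 -[_ == _]negbK neq_lift.
- by rewrite /w0 mulVf // eqxx.
Qed.

(** * Trivial subquotients and Clifford's theorem *)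

Section Subspaces.
Variables (k : fieldType) (r : nat).

(** A matrix of maximal rank with row space inside [P] works, since a vector of [P] outside the row
    space would raise the rank. *)
Lemma subspace_mx (P : 'rV[k]_r -> Prop) :
    P 0 -> (forall c u v, P u -> P v -> P (u + c *: v)) ->
  exists U : 'M[k]_r, forall v, (v <= U)%MS <-> P v.
Proof.
move=> P0 PD.
pose Q s := exists2 U : 'M[k]_r, (s <= \rank U)%N &
  forall v : 'rV_r, (v <= U)%MS -> P v.
have Q0 : Q 0%N by exists 0 => // v; rewrite submx0 => /eqP ->.
have Qr s : Q s -> (s <= r)%N.
  by case=> U /leq_trans + _; apply; apply: rank_leq_row.
have [s [U sU UP] nQ] := last_index_ex Q0 Qr.
exists U => v; split=> [/UP //|Pv]; apply/negPn/negP => nvU; apply: nQ.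
exists (U + v)%MS.
  apply: leq_ltn_trans sU _; apply: rank_ltmx.
  by rewrite ltmxE addsmxSl addsmx_sub submx_refl.
move=> u /sub_addsmxP [[a b] /= ->].
rewrite [b]mx11_scalar mul_scalar_mx; apply: PD => //.
by apply: UP; apply: submxMl.
Qed.

Definition stable (G : 'M[k]_r -> Prop) (A : 'M[k]_r) : Prop :=
  forall g, G g -> (A *m g <= A)%MS.

Lemma stable_sub (G G' : 'M[k]_r -> Prop) A :
  (forall g, G' g -> G g) -> stable G A -> stable G' A.
Proof. by move=> GG' stA g /GG' /stA. Qed.

Lemma stable_adds G A B : stable G A -> stable G B -> stable G (A + B)%MS.
Proof. by move=> sA sB g Gg; rewrite addsmxMr addsmxS ?sA ?sB. Qed.

Lemma stable_cap G A B : stable G A -> stable G B -> stable G (A :&: B)%MS.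
Proof.
move=> sA sB g Gg; rewrite sub_capmx.
by rewrite (submx_trans _ (sA g Gg)) ?(submx_trans _ (sB g Gg)) //;
  apply: submxMr; rewrite ?capmxSl ?capmxSr.
Qed.

Lemma stable_rV G A (v : 'rV_r) g :
  stable G A -> G g -> (v <= A)%MS -> (v *m g <= A)%MS.
Proof. by move=> sA Gg vA; apply: submx_trans (sA g Gg); apply: submxMr. Qed.

Variables G H : 'M[k]_r -> Prop.
Hypotheses (G1 : G 1%:M) (G_unit : forall g, G g -> g \in unitmx)
  (G_inv : forall g, G g -> G (invmx g))
  (G_mul : forall g h, G g -> G h -> G (g *m h))
  (HG : forall h, H h -> G h)
  (H_norm : forall g h, G g -> H h -> H (g *m h *m invmx g)).

(** Moving [h] across [g] turns it into a conjugate, which is in [H] by normality. *)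
Lemma stable_conj A g : G g -> stable H A -> stable H (A *m g).
Proof.
move=> Gg sA h Hh.
have -> : A *m g *m h = A *m (g *m h *m invmx g) *m g.
  by rewrite !mulmxA mulmxKV ?G_unit.
by apply/submxMr/sA/H_norm.
Qed.

Definition simple_quotient (A B : 'M[k]_r) : Prop :=
  forall C : 'M[k]_r, stable G C -> (B <= C)%MS -> (C <= A)%MS ->
    (C <= B)%MS \/ (A <= C)%MS.

Lemma minimal_stable (A B : 'M[k]_r) :
    stable H A -> (B <= A)%MS -> ~~ (A <= B)%MS ->
  exists N : 'M[k]_r, [/\ stable H N, (B <= N)%MS, (N <= A)%MS, ~~ (N <= B)%MS
    & forall C : 'M[k]_r, stable H C -> (B <= C)%MS -> (C <= N)%MS ->
        (C <= B)%MS \/ (N <= C)%MS].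
Proof.
move: {2}(\rank A) (leqnn (\rank A)) => s; elim: s A => [|s IH] A rA sA BA nAB.
  by move: rA nAB; rewrite leqn0 mxrank_eq0 => /eqP ->; rewrite sub0mx.
have [[C [sC BC CA nCB nAC]]|nC] := classic (exists C : 'M[k]_r,
   [/\ stable H C, (B <= C)%MS, (C <= A)%MS, ~~ (C <= B)%MS &
    ~~ (A <= C)%MS]).
  have rC : (\rank C <= s)%N.
    rewrite -ltnS; apply: leq_trans rA; apply: rank_ltmx.
    by rewrite ltmxE CA.
  have [N [? ? NC ? ?]] := IH C rC sC BC nCB.
  by exists N; split=> //; apply: submx_trans CA.
exists A; split=> // C sC BC CA.
have [|nCB] := boolP (C <= B)%MS; first by left.
have [|nAC] := boolP (A <= C)%MS; first by right.
by case: nC; exists C.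
Qed.

(* Clifford's theorem: A/B is semisimple over H, because the translates by G
   of a minimal H-submodule generate it. *)
Lemma simple_quotient_complement (A B N : 'M[k]_r) :
    stable G A -> stable G B -> (B <= A)%MS -> ~~ (A <= B)%MS ->
    simple_quotient A B ->
    stable H N -> (B <= N)%MS -> (N <= A)%MS ->
  exists C : 'M[k]_r, [/\ stable H C, (C <= A)%MS, (C :&: N <= B)%MS
    & (A <= C + N)%MS].
Proof.
move=> sA sB BA nAB simpleAB sN BN NA.
have sHA := stable_sub HG sA; have sHB := stable_sub HG sB.
have [L [sL BL LA nLB minL]] := minimal_stable sHA BA nAB.
(* [C] will have maximal rank among the [H]-stable subspaces between [B] and [A] that meet [N]
   inside [B]. *)
pose Q s := exists C : 'M[k]_r, [/\ (s <= \rank C)%N, stable H C,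
  (B <= C)%MS, (C <= A)%MS & (C :&: N <= B)%MS].
have Q0 : Q 0%N by exists B; split=> //; apply: capmxSl.
have Qr s : Q s -> (s <= r)%N.
  by case=> C [/leq_trans + _ _ _ _]; apply; apply: rank_leq_row.
have [s [C [sr sC BC CA CN]] nQ] := last_index_ex Q0 Qr.
exists C; split=> //; set Y := (C + N)%MS.
have sY : stable H Y by apply: stable_adds.
have [|[g Gg nLY]] : (forall g, G g -> (L *m g <= Y)%MS) \/
    exists2 g, G g & ~~ (L *m g <= Y)%MS.
- have [[g Gg ?]|nex] := classic (exists2 g, G g & ~~ (L *m g <= Y)%MS).
    by right; exists g.
  by left=> g Gg; apply/negPn/negP => nL; apply: nex; exists g.
- move=> LY.
  (* [Z] is the largest [G]-stable subspace of [A] inside [Y]. It contains [L], which is not inside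
     [B], so simplicity forces [A <= Z]. *)
  have [|c u v [uA uY] [vA vY]|Z ZP] := @subspace_mx
      (fun v => (v <= A)%MS /\ forall g, G g -> (v *m g <= Y)%MS).
    by split=> [|g _]; rewrite ?mul0mx sub0mx.
    split=> [|g Gg]; first by rewrite addmx_sub ?scalemx_sub.
    by rewrite mulmxDl -scalemxAl addmx_sub ?scalemx_sub ?uY ?vY.
  have LZ : (L <= Z)%MS.
    apply/rV_subP=> v vL; apply/ZP; split; first exact: submx_trans LA.
    by move=> g Gg; apply: submx_trans (LY g Gg); apply: submxMr.
  have ZA : (Z <= A)%MS by apply/rV_subP=> v /ZP [].
  have sZ : stable G Z.
    move=> g Gg; apply/row_subP=> i; rewrite row_mul.
    have /ZP [iA iY] := row_sub i Z; apply/ZP.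
    split; first exact: stable_rV sA Gg iA.
    by move=> h Gh; rewrite -mulmxA; apply/iY/G_mul.
  case: (simpleAB Z sZ (submx_trans BL LZ) ZA) => [ZB|AZ].
    by case/negP: nLB; apply: submx_trans ZB.
  apply/rV_subP=> v /submx_trans /(_ AZ) /ZP [vA vY].
  by rewrite -[v]mulmx1; apply: vY.
have sLg : stable H (L *m g) by apply: stable_conj.
have LgY : (L *m g :&: Y <= B)%MS.
  (* Pulled back by [g], the intersection is an [H]-stable subspace between [B] and [L]. By
     minimality it is inside [B], as [L *m g] is not inside [Y]. *)
  pose D := ((L *m g :&: Y) *m invmx g)%MS.
  have sD : stable H D.
    by apply: stable_conj; [apply: G_inv | apply: stable_cap].
  have BD : (B <= D)%MS.
    rewrite -[B](mulmxK (G_unit Gg)); apply: submxMr.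
    rewrite sub_capmx submxMr //= (submx_trans (sB g Gg)) //.
    by rewrite (submx_trans BC) ?addsmxSl.
  have DL : (D <= L)%MS.
    by rewrite -[L](mulmxK (G_unit Gg)); apply/submxMr/capmxSl.
  case: (minL D sD BD DL) => [DB|LD].
    rewrite -[X in (X <= _)%MS](mulmxKV (G_unit Gg)).
    by apply: submx_trans (sB g Gg); apply: submxMr.
  case/negP: nLY; apply: submx_trans (capmxSr (L *m g)%MS _).
  by rewrite -[X in (_ <= X)%MS](mulmxKV (G_unit Gg)); apply: submxMr.
(* Adding [L *m g] enlarges [C] and keeps the intersection with [N] inside [B], against
   maximality. *)
case: nQ; exists (C + L *m g)%MS; split.
- apply: leq_ltn_trans sr _; apply: rank_ltmx; rewrite ltmxE.
  rewrite addsmxSl addsmx_sub submx_refl.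
  by apply: contra nLY => /submx_trans; apply; apply: addsmxSl.
- exact: stable_adds.
- by apply: submx_trans BC _; apply: addsmxSl.
- rewrite addsmx_sub CA; apply: submx_trans (sA g Gg); exact: submxMr.
apply/rV_subP=> v; rewrite sub_capmx => /andP[/sub_addsmxP[[a b] /= ev] vN].
have cC : (a *m C <= C)%MS by apply: submxMl.
have bB : (b *m (L *m g) <= B)%MS.
  apply: submx_trans LgY; rewrite sub_capmx submxMl.
  have -> : b *m (L *m g) = v - a *m C by rewrite ev addrC addKr.
  by rewrite addmx_sub ?eqmx_opp ?(submx_trans vN) ?addsmxSr //
    (submx_trans cC) ?addsmxSl.
apply: submx_trans CN; rewrite sub_capmx vN andbT ev addmx_sub //.
exact: submx_trans BC.
Qed.

(* Strong induction on the length of A/B: the witness of a fixed line in an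
   H-subquotient is pushed into C/B or A/C as long as A/B is not simple. *)
Lemma trivial_subquotient_rec (s : nat) (A B N : 'M[k]_r) (u : 'rV[k]_r) :
    (\rank A <= s + \rank B)%N ->
    stable G A -> stable G B -> stable H N ->
    (B <= N)%MS -> (N <= A)%MS -> (u <= A)%MS -> ~~ (u <= N)%MS ->
    (forall h, H h -> (u *m h - u <= N)%MS) ->
  exists A' B' : 'M[k]_r, [/\ stable G A', stable G B', (B' <= A')%MS,
    ~~ (A' <= B')%MS & forall h, H h -> (A' *m h - A' <= B')%MS].
Proof.
elim: s A B N u => [|s IH] A B N u rAB sA sB sN BN NA uA nuN fixu.
  have BA := submx_trans BN NA.
  case/negP: nuN; apply: submx_trans uA _; apply: submx_trans BN.
  by rewrite -(geq_leqif (mxrank_leqif_sup BA)).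
have BA := submx_trans BN NA; have sHB := stable_sub HG sB.
have nAB : ~~ (A <= B)%MS.
  by apply: contra nuN => AB; rewrite (submx_trans uA) // (submx_trans AB).
have [[C [sC BC CA nCB nAC]]|nC] := classic (exists C : 'M[k]_r,
   [/\ stable G C, (B <= C)%MS, (C <= A)%MS, ~~ (C <= B)%MS &
    ~~ (A <= C)%MS]).
  have sHC := stable_sub HG sC.
  have rC : (\rank C < \rank A)%N by apply: rank_ltmx; rewrite ltmxE CA.
  have rB : (\rank B < \rank C)%N by apply: rank_ltmx; rewrite ltmxE BC.
  (* If [u] is in [C + N], its component in [C] is a witness for [C/B], with [N] cut down to
     [C :&: N]. Otherwise [u] is a witness for [A/C], with [N] enlarged to [C + N]. *)
  have [|nuCN] := boolP (u <= C + N)%MS.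
    case/sub_addsmxP=> [[a b] /= eu].
    have cC : (a *m C <= C)%MS by apply: submxMl.
    have nN : (b *m N <= N)%MS by apply: submxMl.
    have ec : a *m C = u - b *m N by rewrite eu addrK.
    apply: (IH C B (C :&: N)%MS (a *m C)) => //.
    - by rewrite -ltnS -addSn; apply: leq_trans rC rAB.
    - exact: stable_cap.
    - by rewrite sub_capmx BC.
    - exact: capmxSl.
    - rewrite sub_capmx cC /=; apply: contra nuN => cN.
      by rewrite eu addmx_sub.
    move=> h Hh; rewrite sub_capmx.
    rewrite addmx_sub ?eqmx_opp ?(stable_rV sHC Hh cC) //=.
    have -> : a *m C *m h - a *m C = (u *m h - u) - (b *m N *m h - b *m N).
      by rewrite ec mulmxBl !opprD addrACA.
    apply: addmx_sub; first exact: fixu.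
    by rewrite eqmx_opp addmx_sub ?eqmx_opp // (stable_rV sN Hh nN).
  apply: (IH A C (C + N)%MS u) => //.
  - by apply: leq_trans rAB _; rewrite addSnnS leq_add2l.
  - exact: stable_adds.
  - exact: addsmxSl.
  - by rewrite addsmx_sub CA.
  by move=> h Hh; apply: submx_trans (fixu h Hh) (addsmxSr _ _).
have simpleAB : simple_quotient A B.
  move=> C sC BC CA.
  have [|nCB] := boolP (C <= B)%MS; first by left.
  have [|nAC] := boolP (A <= C)%MS; first by right.
  by case: nC; exists C.
(* [F/B] is the space of [H]-fixed vectors of [A/B]. It is [G]-stable since [H] is normal, so by
   simplicity it is zero or everything. *)
have [|c v w [vA vB] [wA wB]|F FP] := @subspace_mx
    (fun v => (v <= A)%MS /\ forall h, H h -> (v *m h - v <= B)%MS).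
- by split=> [|h _]; rewrite ?mul0mx ?subr0 sub0mx.
- split=> [|h Hh]; first by rewrite addmx_sub ?scalemx_sub.
  rewrite mulmxDl -scalemxAl opprD addrACA -scalerBr.
  by rewrite addmx_sub ?scalemx_sub ?vB ?wB.
have FA : (F <= A)%MS by apply/rV_subP=> v /FP [].
have BF : (B <= F)%MS.
  apply/rV_subP=> v vB; apply/FP; split; first exact: submx_trans BA.
  by move=> h Hh; rewrite addmx_sub ?eqmx_opp ?(stable_rV sHB).
have sF : stable G F.
  move=> g Gg; apply/row_subP=> i; rewrite row_mul.
  have /FP [iA iB] := row_sub i F; apply/FP.
  split; first exact: stable_rV sA Gg iA.
  move=> h Hh; rewrite -[_ *m h](mulmxKV (G_unit Gg)) -mulmxBl.
  have Hg := H_norm Gg Hh; apply: stable_rV sB Gg _.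
  have -> : row i F *m g *m h *m invmx g = row i F *m (g *m h *m invmx g).
    by rewrite !mulmxA.
  exact: iB.
have [FB|AF] := simpleAB F sF BF FA; last first.
  exists A, B; split=> // h Hh; apply/row_subP=> i; rewrite linearB /= row_mul.
  by have /FP [_ ->] := submx_trans (row_sub i A) AF.
(* When [F/B] is zero, the component of [u] in a complement of [N] modulo [B] is fixed modulo [B],
   hence lies in [B], and [u] falls into [N]. *)
have [C [sC CA CN ACN]] :=
  simple_quotient_complement sA sB BA nAB simpleAB sN BN NA.
have /sub_addsmxP [[a b] /= eu] := submx_trans uA ACN.
have cC : (a *m C <= C)%MS by apply: submxMl.
have nN : (b *m N <= N)%MS by apply: submxMl.
have ec : a *m C = u - b *m N by rewrite eu addrK.
case/negP: nuN; rewrite eu addmx_sub //.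
apply: submx_trans BN; apply: submx_trans FB; apply/FP.
split; first exact: submx_trans CA.
move=> h Hh; apply: submx_trans CN.
rewrite sub_capmx addmx_sub ?eqmx_opp ?(stable_rV sC Hh cC) //=.
have -> : a *m C *m h - a *m C = (u *m h - u) - (b *m N *m h - b *m N).
  by rewrite ec mulmxBl !opprD addrACA.
apply: addmx_sub; first exact: fixu.
by rewrite eqmx_opp addmx_sub ?eqmx_opp // (stable_rV sN Hh nN).
Qed.

Lemma trivial_subquotient (N : 'M[k]_r) (u : 'rV[k]_r) :
    stable H N -> ~~ (u <= N)%MS ->
    (forall h, H h -> (u *m h - u <= N)%MS) ->
  exists A B : 'M[k]_r, [/\ stable G A, stable G B, (B <= A)%MS,
    ~~ (A <= B)%MS & forall h, H h -> (A *m h - A <= B)%MS].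
Proof.
move=> sN nuN fixu.
apply: (@trivial_subquotient_rec r 1%:M 0 N u) => //;
  rewrite ?submx1 ?sub0mx //.
- by rewrite mxrank1 leq_addr.
- by move=> g _; apply: submx1.
- by move=> g _; rewrite mul0mx sub0mx.
Qed.
End Subspaces.

(** * The weak Nullstellensatz *)

Lemma rmorph_mmap (n : nat) (R : nzRingType) (S T : comNzRingType)
    (f : {rmorphism R -> S}) (psi : {rmorphism S -> T}) (h : 'I_n -> S)
    (p : {mpoly R[n]}) :
  psi (mmap f h p) = mmap (psi \o f) (psi \o h) p.
Proof.
rewrite /mmap rmorph_sum; apply: eq_bigr => m _.
rewrite rmorphM rmorph_prod; congr (_ * _).
by apply: eq_bigr => i _; rewrite rmorphXn.
Qed.

Lemma eq_mmap (n : nat) (R S : nzRingType) (f g : R -> S) (h h' : 'I_n -> S)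
    (p : {mpoly R[n]}) :
  f =1 g -> h =1 h' -> mmap f h p = mmap g h' p.
Proof.
move=> fg hh; rewrite /mmap; apply: eq_bigr => m _; rewrite fg.
by congr (_ * _); apply: eq_bigr => i _; rewrite hh.
Qed.

Lemma digits_inj (n b : nat) (e f : 'I_n -> nat) :
    (forall i, (e i < b)%N) -> (forall i, (f i < b)%N) ->
    (\sum_i e i * b ^ i = \sum_i f i * b ^ i)%N -> e =1 f.
Proof.
elim: n e f => [|n IH] e f eb fb; first by move=> _ [].
have b_gt0 : (0 < b)%N by apply: leq_ltn_trans (eb ord0).
have shift (g : 'I_n.+1 -> nat) : (\sum_i g i * b ^ i =
    (\sum_(i < n) g (lift ord0 i) * b ^ i) * b + g ord0)%N.
  rewrite big_ord_recl muln1 addnC; congr (_ + _)%N; rewrite big_distrl /=.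
  by apply: eq_bigr => i _; rewrite -mulnA -expnSr.
rewrite !shift => eq_ef.
have e0 : e ord0 = f ord0.
  rewrite -(modn_small (eb ord0)) -(modn_small (fb ord0)).
  by move/(congr1 (modn^~ b)): eq_ef; rewrite /= !modnMDl.
move/eqP: eq_ef; rewrite e0 eqn_add2r eqn_pmul2r // => /eqP /IH eq_l i.
by case: (unliftP ord0 i) => [j ->|->] //; apply: eq_l.
Qed.

(** Distinct degrees leave a single term of top degree, so its leading coefficient cannot cancel. *)
Lemma size_sum_monic (R : idomainType) (I : eqType) (s : seq I)
    (c : I -> R) (P : I -> {poly R}) (d : I -> nat) :
    s != [::] -> uniq s -> (forall i, i \in s -> c i != 0) ->
    (forall i, P i \is monic) -> (forall i, size (P i) = (d i).+1) ->
    {in s &, injective d} ->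
  exists2 i, i \in s & lead_coef (\sum_(j <- s) c j *: P j) = c i.
Proof.
move=> sN0 us cN0 Pm Pd dinj.
have [i0 i0s dmax] : exists2 i0, i0 \in s &
    forall i, i \in s -> (d i <= d i0)%N.
  case: s sN0 {us cN0 dinj} => // x s _.
  elim: s x => [|y s IH] x.
    by exists x; rewrite ?mem_head // => i; rewrite inE => /eqP ->.
  have [z zs zm] := IH y.
  have [xz|zx] := leqP (d x) (d z).
    exists z; rewrite 1?in_cons ?zs ?orbT // => i.
    by rewrite inE => /predU1P[->|/zm].
  exists x; rewrite ?mem_head // => i; rewrite inE => /predU1P[->//|/zm].
  by move=> /leq_trans; apply; apply: ltnW.
exists i0 => //; rewrite (bigD1_seq i0) //= lead_coefDl.
  by rewrite lead_coefZ (monicP (Pm i0)) mulr1.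
rewrite size_scale ?cN0 // Pd ltnS big_seq_cond.
apply: (big_ind (fun p : {poly R} => (size p <= d i0)%N)).
- by rewrite size_poly0.
- by move=> p q sp sq; apply: leq_trans (size_polyD _ _) _; rewrite geq_max sp.
move=> i /andP[si ni]; rewrite size_scale ?cN0 // Pd ltn_neqAle dmax // andbT.
by apply: contraNneq ni => /dinj ->.
Qed.

(* Nagata's change of variables: the 0-th variable is kept and the (i+1)-st one
   becomes X_i + 'X ^ (b ^ (i+1)), so that distinct monomials with exponents
   below b get distinct degrees in 'X. *)
Definition nagata_var (k : closedFieldType) (n b : nat) (i : 'I_n.+1) :
    {poly {mpoly k[n]}} :=
  if unlift ord0 i is Some j then 'X^(b ^ i) + ('X_j)%:P else 'X.

Definition nagata (k : closedFieldType) (n b : nat) (p : {mpoly k[n.+1]}) :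
    {poly {mpoly k[n]}} :=
  mmap (polyC \o @mpolyC n k) (@nagata_var k n b) p.

Lemma nagata_lead_coef (k : closedFieldType) (n : nat) (p : {mpoly k[n.+1]}) :
  p != 0 ->
  exists b : nat, exists2 c : k, c != 0 & lead_coef (nagata b p) = c%:MP.
Proof.
(* A base above every exponent occurring in [p]: by uniqueness of digits, distinct monomials get
   images of distinct degrees. *)
move=> pN0; pose b := (\max_(m <- msupp p) (mdeg m).+1).+1.
exists b.
have var_monic (i : 'I_n.+1) : 
    (nagata_var k b i \is monic) /\ size (nagata_var k b i) = (b ^ i).+1.
  rewrite /nagata_var; case: unliftP => [j ->|->];
    last by rewrite monicX size_polyX.
  have sC : (size (('X_j)%:P : {poly {mpoly k[n]}}) <
      size ('X^(b ^ lift ord0 j) : {poly {mpoly k[n]}}))%N.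
    by rewrite size_polyXn ltnS (leq_trans (size_polyC_leq1 _)) // expn_gt0.
  by rewrite size_polyDl // size_polyXn monicE lead_coefDl // lead_coefXn.
pose P (m : 'X_{1..n.+1}) := \prod_i nagata_var k b i ^+ m i.
have Pm m : P m \is monic.
  by apply: monic_prod => i _; apply: monic_exp; case: (var_monic i).
have Ps m : size (P m) = (\sum_i m i * b ^ i)%N.+1.
  rewrite /P size_prod => [|i _];
    last by rewrite monic_neq0 // monic_exp // (var_monic i).1.
  have -> : (\sum_i size (nagata_var k b i ^+ m i)%R =
      \sum_i m i * b ^ i + #|'I_n.+1|)%N.
    rewrite -sum1_card -big_split /=; apply: eq_bigr => i _.
    have s_gt0 : (0 < size (nagata_var k b i ^+ m i)%R)%N.
      by rewrite size_poly_gt0 monic_neq0 // monic_exp // (var_monic i).1.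
    by rewrite -(prednK s_gt0) size_exp (var_monic i).2 addn1 mulnC.
  by rewrite -addSn addnK.
have expb m i : m \in msupp p -> (m i < b)%N.
  move=> mp; rewrite ltnS.
  apply: leq_trans
    (@leq_bigmax_seq _ (msupp p) predT (fun m => (mdeg m).+1) m mp isT).
  by rewrite mdegE (bigD1 i) //= leqW // leq_addr.
have -> : nagata b p = \sum_(m <- msupp p) (p@_m)%:MP *: P m.
  by apply: eq_bigr => m _; rewrite mul_polyC.
have sN0 : (msupp p : seq _) != [::] by rewrite msupp_eq0.
have cN0 m : m \in msupp p -> (p@_m)%:MP != 0 :> {mpoly k[n]}.
  by move=> mp; rewrite mpolyC_eq0 mcoeff_eq0 mp.
have dinj : {in msupp p &,
    injective (fun m : 'X_{1..n.+1} => \sum_i m i * b ^ i)%N}.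
  move=> m1 m2 m1p m2p /digits_inj eqm; apply/mnmP.
  by apply: eqm => i; apply: expb.
have [m mp ->] := size_sum_monic sN0 (msupp_uniq p) cN0 Pm Ps dinj.
by exists p@_m; rewrite ?mcoeff_eq0 ?mp.
Qed.

Section Extension.
Variables (k : closedFieldType) (R : comNzRingType) (B : comNzRingType).
Variables (phi : {rmorphism R -> k}) (psi : {rmorphism R -> B}) (b : B).
Variable J : B -> Prop.
Hypotheses (J0 : J 0) (JD : forall x y, J x -> J y -> J (x + y))
  (JM : forall x y, J y -> J (x * y)) (J1 : ~ J 1)
  (J_phi : forall r, J (psi r) -> phi r = 0).

(** The aim is to extend the point [phi] of [R] to a point of [{poly R}] that kills every polynomial
    sent into the ideal [J] by this evaluation. *)
Let ev (P : {poly R}) : B := (map_poly psi P).[b].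

(* Lying over, by the determinant trick: multiplication by P on the free
   module R['X]/(g) has a determinant which lies in J, although it specializes
   to 1 when P does. *)
Lemma integral_proper (g P : {poly R}) :
  g \is monic -> J (ev g) -> J (ev P) -> map_poly phi P != 1.
Proof.
move=> gm Jg JP; apply/eqP=> P1.
have evM u v : ev (u * v) = ev u * ev v by rewrite /ev rmorphM hornerM.
have evB u v : ev (u - v) = ev u - ev v by rewrite /ev rmorphB hornerD hornerN.
have JN x : J x -> J (- x) by rewrite -mulN1r; apply: JM.
have sg_gt0 : (0 < size g)%N by rewrite size_poly_gt0 monic_neq0.
have [d sg] : exists d, size g = d.+2.
  case E: (size g) sg_gt0 => [|[|d]] // _; last by exists d.
  case: J1; suff <- : ev g = 1 by [].
  have /size1_polyC eg : (size g <= 1)%N by rewrite E.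
  move/monicP: gm; rewrite eg lead_coefC => ->.
  by rewrite /ev rmorph1 hornerC.
pose rem i := Pdiv.Ring.rmodp ('X^i * P) g.
have rem_size i : (size (rem i) <= d.+1)%N.
  by rewrite -ltnS -sg Pdiv.Ring.ltn_rmodpN0 ?monic_neq0.
have remE i : rem i = 'X^i * P - Pdiv.Ring.rdivp ('X^i * P) g * g.
  apply/eqP; rewrite eq_sym subr_eq addrC; apply/eqP.
  exact: Pdiv.RingMonic.rdivp_eq.
have Jrem i : J (ev (rem i)).
  by rewrite remE evB !evM; apply: JD; [apply: JM | apply/JN/JM].
(* The matrix of multiplication by [P] modulo [g] in the basis of powers of ['X]. Under [phi] it
   becomes the identity, since [P] becomes 1 and ['X^i] is already reduced. *)
pose A : 'M[R]_d.+1 := \matrix_(i, j) (rem i)`_j.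
have phiA : map_mx phi A = 1%:M.
  apply/matrixP=> i j; rewrite !mxE -coef_map.
  suff -> : map_poly phi (rem i) = 'X^i by rewrite coefXn eq_sym.
  have gphi : map_poly phi g \is monic by apply: monic_map.
  have := remE i => /(congr1 (map_poly phi)).
  rewrite rmorphB !rmorphM /= P1 mulr1 map_polyXn => e.
  set q := map_poly phi (Pdiv.Ring.rdivp _ _) in e.
  suff q0 : q = 0 by rewrite e q0 mul0r subr0.
  apply/eqP/negPn/negP => qN0.
  have : (size (q * map_poly phi g)%R <= d.+1)%N.
    have -> : q * map_poly phi g = 'X^i - map_poly phi (rem i).
      by rewrite e opprB addrC subrK.
    apply: leq_trans (size_polyD _ _) _; rewrite size_polyN size_polyXn.
    rewrite geq_max ltn_ord.
    by apply: leq_trans (size_poly _ _) (rem_size i).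
  rewrite size_Mmonic // size_map_poly_id0 ?(monicP gm) ?rmorph1 ?oner_neq0 //.
  have : (0 < size q)%N by rewrite size_poly_gt0.
  rewrite sg; case: (size q) => // t _; rewrite addSn /=.
  by move/(leq_trans (leq_addl t _)); rewrite ltnn.
(* The image of [A] under [psi] sends the column of powers of [b] into [J]. Applying the adjugate
   and reading the entry of [b ^+ 0] gives the determinant. *)
have Jdet : J (psi (\det A)).
  pose y : 'cV[B]_d.+1 := \col_j b ^+ j.
  have Ay i : (map_mx psi A *m y) i ord0 = ev (rem i).
    rewrite mxE /ev (@horner_coef_wide _ d.+1) ?(leq_trans (size_poly _ _)) //.
    by apply: eq_bigr => j _; rewrite !mxE coef_map.
  have -> : psi (\det A) =
      (\adj (map_mx psi A) *m (map_mx psi A *m y)) ord0 ord0.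
    by rewrite mulmxA mul_adj_mx mul_scalar_mx !mxE expr0 mulr1 det_map_mx.
  rewrite mxE; elim/big_ind: _ => // i _.
  by rewrite Ay; apply: JM.
by move/J_phi/eqP: Jdet; rewrite -det_map_mx phiA det1 oner_eq0.
Qed.

Variable iota : {rmorphism k -> R}.
Hypothesis phiK : forall c, phi (iota c) = c.

(** The images under [phi] of the [P] with [ev P] in [J] form an ideal, proper by [integral_proper].
    A nonzero member of least degree has a root and divides all the others. *)
Lemma extend_point (g : {poly R}) :
    g \is monic -> J (ev g) ->
  exists x : k, forall P : {poly R}, J (ev P) -> (map_poly phi P).[x] = 0.
Proof.
move=> gm Jg.
pose Q s := exists P : {poly R},
  [/\ J (ev P), map_poly phi P != 0 & size (map_poly phi P) = s].
have [s [P0 [JP0 P0N0 sP0]] smin] :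
    exists2 s, Q s & forall s', Q s' -> (s <= s')%N.
  have Qg : Q (size (map_poly phi g)).
    by exists g; split; rewrite // monic_neq0 ?monic_map.
  elim/ltn_ind: (size _) Qg => s IH Qs.
  have [[s' ss' /IH[]//]|nex] := classic (exists2 s', (s' < s)%N & Q s').
    by move=> t Qt tm; exists t.
  exists s => // s' Qs'; rewrite leqNgt; apply/negP => ss'.
  by apply: nex; exists s'.
have liftK (q : {poly k}) : map_poly phi (map_poly iota q) = q.
  by rewrite -map_poly_comp map_poly_id // => c _; apply: phiK.
have : size (map_poly phi P0) != 1%N.
  apply/negP => /size_poly1P [c cN0 e].
  have JP1 : J (ev (map_poly iota c^-1%:P * P0)).
    by rewrite /ev rmorphM hornerM; apply: JM.
  have /eqP := integral_proper gm Jg JP1.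
  by apply; rewrite rmorphM /= e liftK -polyCM mulVf.
case/closed_rootP=> x /rootP xP0; exists x => P JP.
pose q := map_poly phi P %/ map_poly phi P0.
have eP : map_poly phi P =
    q * map_poly phi P0 + map_poly phi P %% map_poly phi P0.
  exact: divp_eq.
have [r0|rN0] := eqVneq (map_poly phi P %% map_poly phi P0) 0.
  by rewrite eP r0 addr0 hornerM xP0 mulr0.
have : Q (size (map_poly phi P %% map_poly phi P0)).
  exists (P - map_poly iota q * P0).
  have -> : map_poly phi (P - map_poly iota q * P0) =
      map_poly phi P %% map_poly phi P0.
    by rewrite rmorphB rmorphM /= liftK {1}eP addrC addKr.
  split=> //; rewrite /ev rmorphB rmorphM hornerD hornerN hornerM.
  by apply: JD => //; rewrite -mulNr; apply: JM.
by move/smin; rewrite -sP0 leqNgt ltn_modp P0N0.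
Qed.
End Extension.

(** [B] and [J] stay fixed while the tuple grows. If no nonzero polynomial relation holds modulo
    [J], any point will do. Otherwise Nagata's substitution makes a relation monic in one variable,
    up to a scalar, and [extend_point] adds that coordinate. *)
Lemma nullstellensatz_tuple (k : closedFieldType) (B : comNzRingType)
    (iota : {rmorphism k -> B}) (J : B -> Prop) (J0 : J 0)
    (JD : forall x y, J x -> J y -> J (x + y))
    (JM : forall x y, J y -> J (x * y)) (J1 : ~ J 1)
    (n : nat) (b : 'I_n -> B) :
  exists a : 'I_n -> k, forall p : {mpoly k[n]},
    J (mmap iota b p) -> p.@[a] = 0.
Proof.
elim: n b => [|n IH] b.
  exists (fun=> 0) => p; have [->|pN0] := eqVneq p 0; first by rewrite meval0.
  have -> : p = (p@_0%MM)%:MP.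
    apply: msize1_polyC; rewrite msizeE; apply/bigmax_leqP_seq => m _ _.
    by rewrite mdegE big_ord0.
  rewrite mmapC mevalC => Jc; have [//|cN0] := eqVneq p@_0%MM 0.
  by case: J1; rewrite -(rmorph1 iota) -(mulVf cN0) rmorphM; apply: JM.
have [[p pN0 Jp]|alg_free] := classic (exists2 p : {mpoly k[n.+1]},
    p != 0 & J (mmap iota b p)); last first.
  exists (fun=> 0) => p Jp.
  have [->|pN0] := eqVneq p 0; first by rewrite meval0.
  by case: alg_free; exists p.
have [N [c cN0 lc]] := nagata_lead_coef pN0.
(* Chosen so that evaluating the transformed polynomial at [b'] and [b ord0] gives back the value of
   the original one at [b]. *)
pose b' i := b (lift ord0 i) - b ord0 ^+ (N ^ lift ord0 i).
have [a Ja] := IH b'.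
pose psi : {rmorphism {mpoly k[n]} -> B} := mmap iota b'.
pose phi : {rmorphism {mpoly k[n]} -> k} := meval a.
have ev_nagata (q : {mpoly k[n.+1]}) :
    (map_poly psi (nagata N q)).[b ord0] = mmap iota b q.
  rewrite -[LHS]/((horner_eval (b ord0) \o map_poly psi) (nagata N q)).
  rewrite rmorph_mmap; apply: eq_mmap => [x|i] /=.
    by rewrite map_polyC /= /horner_eval hornerC mmapC.
  rewrite /nagata_var /horner_eval; case: unliftP => [j ->|->].
    by rewrite rmorphD /= map_polyXn map_polyC /=;
    rewrite hornerD hornerXn hornerC mmapX mmap1U addrC subrK.
  by rewrite map_polyX hornerX.
have := @extend_point k {mpoly k[n]} B phi psi (b ord0) J J0 JD JM J1 Ja
  (@mpolyC n k) (fun c => mevalC _ c) ((c^-1)%:MP *: nagata N p).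
case=> [||x Px].
- by rewrite monicE lead_coefZ lc -mpolyCM mulVf.
- by rewrite -mul_polyC rmorphM hornerM; apply: JM; rewrite ev_nagata.
exists (fun i => if unlift ord0 i is Some j then x ^+ (N ^ i) + a j else x).
move=> q Jq; rewrite -[RHS](Px (nagata N q)) ?ev_nagata //.
rewrite -[RHS]/((horner_eval x \o map_poly phi) (nagata N q)).
rewrite rmorph_mmap; apply: eq_mmap => [y|i] /=.
  by rewrite map_polyC /= /horner_eval hornerC mevalC.
rewrite /nagata_var /horner_eval; case: unliftP => [j _|_].
  by rewrite rmorphD /= map_polyXn map_polyC /=;
    rewrite hornerD hornerXn hornerC mevalXU.
by rewrite map_polyX hornerX.
Qed.

Theorem weak_nullstellensatz (k : closedFieldType) (n : nat)
    (J : {mpoly k[n]} -> Prop) :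
    J 0 -> (forall p q, J p -> J q -> J (p + q)) ->
    (forall p q, J q -> J (p * q)) -> ~ J 1 ->
  exists a : 'I_n -> k, forall p, J p -> p.@[a] = 0.
Proof.
move=> J0 JD JM J1.
have [a Ja] := nullstellensatz_tuple (@mpolyC n k) J0 JD JM J1
  (fun i => 'X_i).
exists a => p Jp; apply: Ja.
suff -> : mmap (@mpolyC n k) (fun i => 'X_i) p = p by [].
rewrite [RHS]mpolyE; apply: eq_bigr => m _.
by rewrite mmap1_id mul_mpolyC.
Qed.

(** * Regular functions *)

Section RegularFunctions.
Variable k : closedFieldType.

Lemma regular_const (n : nat) (X : 'rV[k]_n -> Prop) (c : k) :
  regular_function X (fun=> c).
Proof. by exists c%:MP => x _; rewrite mevalC. Qed.

Lemma regularD (n : nat) (X : 'rV[k]_n -> Prop) (f g : 'rV[k]_n -> k) :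
  regular_function X f -> regular_function X g ->
  regular_function X (fun x => f x + g x).
Proof.
by move=> [p fp] [q gq]; exists (p + q) => x Xx; rewrite mevalD fp ?gq.
Qed.

Lemma regularM (n : nat) (X : 'rV[k]_n -> Prop) (f g : 'rV[k]_n -> k) :
  regular_function X f -> regular_function X g ->
  regular_function X (fun x => f x * g x).
Proof.
by move=> [p fp] [q gq]; exists (p * q) => x Xx; rewrite mevalM fp ?gq.
Qed.

Lemma eq_regular (n : nat) (X : 'rV[k]_n -> Prop) (f g : 'rV[k]_n -> k) :
  (forall x, X x -> f x = g x) -> regular_function X f -> regular_function X g.
Proof. by move=> fg [p fp]; exists p => x Xx; rewrite -fg ?fp. Qed.

Lemma regular_sum (n : nat) (X : 'rV[k]_n -> Prop) (I : Type) (s : seq I)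
    (f : I -> 'rV[k]_n -> k) :
  (forall i, regular_function X (f i)) ->
  regular_function X (fun x => \sum_(i <- s) f i x).
Proof.
move=> rf; elim: s => [|i s IH].
  by apply: eq_regular (regular_const X 0) => x _; rewrite big_nil.
by apply: eq_regular (regularD (rf i) IH) => x _; rewrite big_cons.
Qed.

Lemma regular_prod (n : nat) (X : 'rV[k]_n -> Prop) (I : Type) (s : seq I)
    (f : I -> 'rV[k]_n -> k) :
  (forall i, regular_function X (f i)) ->
  regular_function X (fun x => \prod_(i <- s) f i x).
Proof.
move=> rf; elim: s => [|i s IH].
  by apply: eq_regular (regular_const X 1) => x _; rewrite big_nil.
by apply: eq_regular (regularM (rf i) IH) => x _; rewrite big_cons.
Qed.

Lemma regular_det (n : nat) (X : 'rV[k]_n -> Prop) (s : nat)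
    (A : 'rV[k]_n -> 'M[k]_s) :
  (forall i j, regular_function X (fun x => A x i j)) ->
  regular_function X (fun x => \det (A x)).
Proof.
move=> rA; apply: regular_sum => t; apply: regularM (regular_const _ _) _.
exact: regular_prod.
Qed.

Lemma regular_mulmx (n : nat) (X : 'rV[k]_n -> Prop) (s t u : nat)
    (A : 'rV[k]_n -> 'M[k]_(s, t)) (B : 'rV[k]_n -> 'M[k]_(t, u)) :
  (forall i j, regular_function X (fun x => A x i j)) ->
  (forall i j, regular_function X (fun x => B x i j)) ->
  forall i j, regular_function X (fun x => (A x *m B x) i j).
Proof.
move=> rA rB i j.
apply: eq_regular (regular_sum _ (fun l => regularM (rA i l) (rB l j))).
by move=> x _; rewrite mxE.
Qed.

Lemma regular_coord (n : nat) (X : 'rV[k]_n -> Prop) (i : 'I_n) :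
  regular_function X (fun x => x ord0 i).
Proof. by exists 'X_i => x _; rewrite mevalXU. Qed.

Lemma regular_comp (n m : nat) (X : 'rV[k]_n -> Prop) (Y : 'rV[k]_m -> Prop)
    (F : 'rV[k]_n -> 'rV[k]_m) (f : 'rV[k]_m -> k) :
  variety_morphism X Y F -> regular_function Y f ->
  regular_function X (fun x => f (F x)).
Proof.
move=> [FXY rF] [p fp].
have [q Fq] := fin_all_exists rF.
exists (mmap (@mpolyC n k) q p) => x Xx.
rewrite fp; last exact: FXY.
rewrite -[RHS]/((meval (x ord0)) (mmap (@mpolyC n k) q p)) rmorph_mmap.
by apply: eq_mmap => [c|j] /=; rewrite ?mevalC ?Fq.
Qed.

(** * Degree bounds and linear substitutions *)

Lemma msize_mul_le (n : nat) (p q : {mpoly k[n]}) (a b : nat) :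
  (msize p <= a.+1)%N -> (msize q <= b.+1)%N -> (msize (p * q) <= (a + b).+1)%N.
Proof.
have [->|pN0] := eqVneq p 0; first by rewrite mul0r msize0.
have [->|qN0] := eqVneq q 0; first by rewrite mulr0 msize0.
move=> pa qb; rewrite msizeM // -ltnS prednK; last first.
  by rewrite addn_gt0 lt0n msize_poly_eq0 pN0.
by rewrite -addSn -addnS leq_add.
Qed.

Lemma msize_sum_le (n d : nat) (I : Type) (s : seq I) (P : pred I)
    (F : I -> {mpoly k[n]}) :
  (forall i, P i -> (msize (F i) <= d)%N) ->
  (msize (\sum_(i <- s | P i) F i) <= d)%N.
Proof.
move=> Fd; elim/big_ind: _ => //; first by rewrite msize0.
by move=> p q pd qd; apply: leq_trans (msizeD_le _ _) _; rewrite geq_max pd.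
Qed.

Lemma msize_mmap1 (n r : nat) (h : 'I_r -> {mpoly k[n]}) (m : 'X_{1..r}) :
  (forall i, msize (h i) <= 2)%N -> (msize (mmap1 h m) <= (mdeg m).+1)%N.
Proof.
move=> hs; rewrite mdegE /mmap1.
elim: (index_enum _) => [|i s IH]; first by rewrite !big_nil msize1.
rewrite !big_cons; apply: msize_mul_le => //.
elim: (m i) => [|d IHd]; first by rewrite expr0 msize1.
by rewrite exprS; apply: (@msize_mul_le _ _ _ 1 d).
Qed.

Definition linear_subst (s r : nat) (T : 'M[k]_(s, r)) (p : {mpoly k[s]}) :
    {mpoly k[r]} :=
  mmap (@mpolyC r k) (fun i => \sum_j T i j *: 'X_j) p.

Lemma meval_linear_subst (s r : nat) (T : 'M[k]_(s, r)) (p : {mpoly k[s]})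
    (y : 'cV[k]_r) :
  (linear_subst T p).@[y^~ ord0] = p.@[(T *m y)^~ ord0].
Proof.
rewrite -[LHS]/(meval (y^~ ord0) (mmap (@mpolyC r k) _ p)) rmorph_mmap.
apply: eq_mmap => [c|i] /=; first by rewrite mevalC.
by rewrite raddf_sum mxE; apply: eq_bigr => j _; rewrite /= mevalZ mevalXU.
Qed.

Lemma msize_linear_subst (s r : nat) (T : 'M[k]_(s, r)) (p : {mpoly k[s]}) :
  (msize (linear_subst T p) <= msize p)%N.
Proof.
rewrite /linear_subst /mmap big_seq; apply: msize_sum_le => m mp.
rewrite mul_mpolyC; apply: leq_trans (msizeZ_le _ _) _.
apply: leq_trans (msize_mdeg_lt mp); apply: msize_mmap1 => i.
apply: msize_sum_le => j _; apply: leq_trans (msizeZ_le _ _) _.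
by rewrite msizeX mdeg1.
Qed.

(* A polynomial vanishes on T^-1 X as soon as it does on X: on the finite
   dimensional space of restrictions to X of polynomials of bounded degree,
   composition with T is onto, hence one-to-one. *)
Lemma vanish_invmx (r : nat) (X : 'cV[k]_r -> Prop) (T : 'M[k]_r)
    (q : {mpoly k[r]}) :
    T \in unitmx -> (forall y, X y -> X (T *m y)) ->
    (forall y, X y -> q.@[y^~ ord0] = 0) ->
  forall y, X y -> q.@[(invmx T *m y)^~ ord0] = 0.
Proof.
move=> Tu TX qX.
pose S (f : 'cV[k]_r -> k) := exists2 p : {mpoly k[r]}, (msize p <= msize q)%N &
  forall y, X y -> f y = p.@[y^~ ord0].
have [f g fg [p ps pf]|||f [p ps pf]|s [w [p [Sw Xp wp wE]]]] :=
    @dual_basis k _ X S 'X_{1..r < msize q} (fun m y => 'X_[m].@[y^~ ord0]).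
- by exists p => // y Xy; rewrite -fg ?pf.
- by exists 0; rewrite ?msize0 // => y _; rewrite meval0.
- move=> c f g [p ps pf] [p' ps' pg]; exists (p + c *: p').
    apply: leq_trans (msizeD_le _ _) _; rewrite geq_max ps.
    exact: leq_trans (msizeZ_le _ _) ps'.
  by move=> y Xy; rewrite mevalD mevalZ pf ?pg.
- exists (fun m : 'X_{1..r < msize q} => p@_m) => y Xy.
  rewrite pf // [in LHS](mpolywE ps) raddf_sum.
  by apply: eq_bigr => m _; rewrite /= mevalZ.
have /fin_all_exists [P wP] (i : 'I_s) : exists P : {mpoly k[r]},
    (msize P <= msize q)%N /\ forall y, X y -> w i y = P.@[y^~ ord0].
  by have [P] := Sw i; exists P.
have Scomp (U : 'M_r) p' : (msize p' <= msize q)%N ->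
    S (fun y => (linear_subst U p').@[y^~ ord0]).
  move=> ps; exists (linear_subst U p') => //.
  by apply: leq_trans ps; apply: msize_linear_subst.
pose A := \matrix_(i, j) w i (T *m p j).
have wT i y : X y -> w i (T *m y) = \sum_j A i j * w j y.
  move=> Xy; have [Ps Pw] := wP i.
  rewrite Pw; last exact: TX.
  rewrite -meval_linear_subst (wE _ (Scomp T _ Ps)) //.
  by apply: eq_bigr => j _; rewrite mxE meval_linear_subst Pw //; apply: TX.
(* [invmx T] is not known to preserve [X], so the [P i] composed with it are only restricted to [X].
   Composing with [T] afterwards gives back [w i], hence [C] inverts [A]. *)
pose C := \matrix_(i, j) (linear_subst (invmx T) (P i)).@[(p j)^~ ord0].
have CA : C *m A = 1%:M.
  apply/matrixP=> i j; rewrite [RHS]mxE -wp; have [Ps Pw] := wP i.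
  rewrite Pw // -[p j](mulKmx Tu) -meval_linear_subst.
  rewrite (wE _ (Scomp (invmx T) _ Ps)) ?mxE; last exact: TX.
  by apply: eq_bigr => l _; rewrite !mxE.
have Sq := Scomp (invmx T) q (leqnn _).
move=> y Xy; rewrite -meval_linear_subst (wE _ Sq) // big1 // => i _.
(* The coordinates of [q] composed with [invmx T]. The entries of [v *m A] are the values of [q] at
   the [p j], which are 0. *)
pose v : 'rV_s := \row_i (linear_subst (invmx T) q).@[(p i)^~ ord0].
suff v0 : v = 0 by move/rowP/(_ i): v0; rewrite !mxE => ->; rewrite mul0r.
have [_ Au] := mulmx1_unit CA; apply: (can_inj (mulmxK Au)); rewrite mul0mx.
apply/rowP=> j; rewrite !mxE -[RHS](qX (p j)) // -[p j](mulKmx Tu).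
rewrite -meval_linear_subst (wE _ Sq); last exact: TX.
by apply: eq_bigr => l _; rewrite !mxE.
Qed.

End RegularFunctions.

(** * Representations of affine monoids *)

(** The rows of [e] form a basis of a complement of [A :&: B] in [A], and [P] reads coordinates in
    it modulo [B]. For stable [B <= A], [e *m g *m P] is then the matrix of [g] on [A/B]. *)
Lemma quotient_block (k : fieldType) (r : nat) (A B : 'M[k]_r) :
    ~~ (A <= B)%MS ->
  exists (s : nat) (e : 'M[k]_(s, r)) (P : 'M[k]_(r, s)),
    [/\ (0 < s)%N, (e <= A)%MS, e *m P = 1%:M,
        forall t (X : 'M_(t, r)), (X <= B)%MS -> X *m P = 0
      & forall t (X : 'M_(t, r)), (X <= A)%MS -> (X - X *m P *m e <= B)%MS].
Proof.
move=> nAB; pose E := (A :\: B)%MS.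
have EB : (E :&: B = 0)%MS by apply: capmx_diff.
have AE : (A <= E + A :&: B)%MS by rewrite addsmx_diff_cap_eq.
have AEB : (A <= E + B)%MS.
  by apply: submx_trans AE _; rewrite addsmxS ?capmxSr.
exists (\rank E), (row_base E), (proj_mx E B *m pinvmx (row_base E)); split.
- rewrite lt0n mxrank_eq0; apply: contra nAB => /eqP E0.
  by apply: submx_trans AE _; rewrite E0 adds0mx_id capmxSr.
- by rewrite eq_row_base diffmxSl.
- by rewrite mulmxA proj_mx_id ?eq_row_base // mulmxVp ?row_base_free.
- by move=> t X XB; rewrite mulmxA proj_mx_0 // mul0mx.
move=> t X XA; rewrite mulmxA mulmxKpV; last by rewrite eq_row_base proj_mx_sub.
by apply: proj_mx_compl_sub; apply: submx_trans AEB.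
Qed.

Section Monoid.
Variables (k : closedFieldType) (M : affineMonoid k).
Local Notation n := (mdim M).
Local Notation "x ** y" := (@mmul k M x y) (at level 40, left associativity).
Local Notation one := (mone M).

Lemma product_row (x y : 'rV[k]_n) :
  M x -> M y -> variety_product M M (row_mx x y).
Proof. by move=> Mx My; split; rewrite ?row_mxKl ?row_mxKr. Qed.

Lemma mmul_points (x y : 'rV[k]_n) : M x -> M y -> M (x ** y).
Proof.
move=> Mx My; have [+ _] := mmul_morphism M.
by move=> /(_ _ (product_row Mx My)); rewrite row_mxKl row_mxKr.
Qed.

Lemma regular_translate (f : 'rV[k]_n -> k) (y : 'rV[k]_n) :
  regular_function M f -> M y -> regular_function M (fun x => f (x ** y)).
Proof.
move=> rf My; apply: (regular_comp (F := fun x => x ** y)) rf.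
split=> [x Mx|j]; first exact: mmul_points.
have [_ /(_ j) rj] := mmul_morphism M.
have rp : variety_morphism M (variety_product M M) (fun x => row_mx x y).
  split=> [x Mx|i]; first exact: product_row.
  rewrite -(splitK i); case: (split i) => l /=.
    by apply: eq_regular (regular_coord _ l) => x _; rewrite row_mxEl.
  by apply: eq_regular (regular_const _ (y ord0 l)) => x _; rewrite row_mxEr.
apply: eq_regular (regular_comp rp rj) => x _.
by rewrite row_mxKl row_mxKr.
Qed.

(** Each monomial in the coordinates of the pair [x], [y] splits into a part in [x] and a part in
    [y]. Hence all left translates of the [f j] lie in one finite dimensional span. *)
Lemma mul_expand (s : nat) (f : 'I_s -> 'rV[k]_n -> k) :
    (forall j, regular_function M (f j)) ->
  exists (I : finType) (m : I -> 'rV[k]_n -> k)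
      (c : 'I_s -> I -> 'rV[k]_n -> k),
    (forall i, regular_function M (m i)) /\
    forall j x y, M x -> M y -> f j (x ** y) = \sum_i c j i x * m i y.
Proof.
move=> rf.
have /fin_all_exists [Q fQ] (j : 'I_s) :=
  regular_comp (mmul_morphism M) (rf j).
pose D := \max_j msize (Q j).
exists ('X_{1..(n + n)%N < D} : finType).
exists (fun (e : 'X_{1..(n + n)%N < D}) (y : 'rV_n) =>
  \prod_(i < n) y ord0 i ^+ bmnm e (rshift n i)).
exists (fun j (e : 'X_{1..(n + n)%N < D}) (x : 'rV_n) =>
  (Q j)@_e * \prod_(i < n) x ord0 i ^+ bmnm e (lshift n i)).
split=> [e|j x y Mx My].
  exists (\prod_(i < n) 'X_i ^+ bmnm e (rshift n i)) => x _.
  by rewrite rmorph_prod; apply: eq_bigr => i _; rewrite rmorphXn /= mevalXU.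
have := fQ j _ (product_row Mx My); rewrite row_mxKl row_mxKr => ->.
have QD : (msize (Q j) <= D)%N by apply: (leq_bigmax j).
rewrite [in LHS](mpolywE QD) raddf_sum; apply: eq_bigr => e _ /=.
rewrite mevalZ mevalX big_split_ord -mulrA; congr (_ * (_ * _));
  by apply: eq_bigr => i _; rewrite ?row_mxEl ?row_mxEr.
Qed.

Definition representation (r : nat) (tau : 'rV[k]_n -> 'M[k]_r) : Prop :=
  [/\ forall i j, regular_function M (fun x => tau x i j),
      tau one = 1%:M
    & forall x y, M x -> M y -> tau (x ** y) = tau x *m tau y].

Definition translation_vector (r : nat) (tau : 'rV[k]_n -> 'M[k]_r)
    (w : 'rV[k]_n -> 'cV[k]_r) : Prop :=
  (forall i, regular_function M (fun x => w x i ord0)) /\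
  forall x y, M x -> M y -> w (x ** y) = tau x *m w y.

(* The representation of M on the largest space of functions which lies in the
   span of the m_i and is stable under left translations; the entries of w form
   a basis of it. *)
Lemma translation_representation (I : finType) (m : I -> 'rV[k]_n -> k) :
    (forall i, regular_function M (m i)) ->
  exists (r : nat) (tau : 'rV[k]_n -> 'M[k]_r) (w : 'rV[k]_n -> 'cV[k]_r),
    [/\ representation tau, translation_vector tau w,
        forall f : 'rV[k]_n -> k,
          (forall a, M a -> exists c : I -> k,
             forall x, M x -> f (a ** x) = \sum_i c i * m i x) ->
          exists v : 'rV[k]_r, forall x, M x -> f x = (v *m w x) ord0 ord0
      & forall a, M a -> (forall i x, M x -> m i (a ** x) = 0) -> tau a = 0].
Proof.
move=> rm.
pose S (f : 'rV[k]_n -> k) := forall a, M a -> exists c : I -> k,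
  forall x, M x -> f (a ** x) = \sum_i c i * m i x.
have M1 := mone_points M.
have S1 f : S f -> exists c : I -> k, forall x, M x -> f x = \sum_i c i * m i x.
  move=> /(_ _ M1) [c fc]; exists c => x Mx.
  by rewrite -fc ?mmul1x.
have [f g fg Sf a Ma|a Ma|c f g Sf Sg a Ma|//|r [w [p [Sw Mp wp wE]]]] :=
    @dual_basis k _ M S I m.
- have [c fc] := Sf a Ma; exists c => x Mx.
  by rewrite -fg ?fc //; apply: mmul_points.
- by exists (fun=> 0) => x Mx; rewrite big1 // => i _; rewrite mul0r.
- have [cf fc] := Sf a Ma; have [cg gc] := Sg a Ma.
  exists (fun i => cf i + c * cg i) => x Mx; rewrite fc // gc // mulr_sumr.
  by rewrite -big_split; apply: eq_bigr => i _; rewrite mulrDl mulrA.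
have St f a : M a -> S f -> S (fun x => f (a ** x)).
  move=> Ma Sf b Mb; have [c fc] := Sf _ (mmul_points Ma Mb).
  by exists c => x Mx; rewrite mmulA ?fc.
have Sreg f : S f -> regular_function M f.
  move=> /S1 [c fc]; apply: (eq_regular (f := fun x => \sum_i c i * m i x)).
    by move=> x /fc.
  by apply: regular_sum => i; apply: regularM (regular_const _ _) (rm i).
(* The coordinates of the translate of [w i] by [a], read off at the dual points. As functions of
   [a] these are right translates of [w i], hence regular. *)
pose tau a := \matrix_(i, j) w i (a ** p j).
pose W x := \col_i w i x.
have WE x y : M x -> M y -> W (x ** y) = tau x *m W y.
  move=> Mx My; apply/colP=> i; rewrite !mxE (wE _ (St _ _ Mx (Sw i))) //.
  by apply: eq_bigr => j _; rewrite !mxE.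
exists r, tau, W; split.
- split=> [i j||x y Mx My].
  + apply: eq_regular (regular_translate (Sreg _ (Sw i)) (Mp j)) => x _.
    by rewrite mxE.
  + by apply/matrixP=> i j; rewrite !mxE mmul1x.
  apply/matrixP=> i j; rewrite !mxE -mmulA //.
  have /colP/(_ i) := WE x (y ** p j) Mx (mmul_points My (Mp j)).
  by rewrite !mxE => ->; apply: eq_bigr => l _; rewrite !mxE.
- split=> // i; apply: eq_regular (Sreg _ (Sw i)) => x _; by rewrite mxE.
- move=> f Sf; exists (\row_i f (p i)) => x Mx; rewrite mxE (wE f Sf x Mx).
  by apply: eq_bigr => i _; rewrite !mxE.
move=> a Ma m0; apply/matrixP=> i j; rewrite !mxE.
have [c wc] := S1 _ (Sw i); rewrite wc; last exact: mmul_points.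
by rewrite big1 // => l _; rewrite m0 ?mulr0.
Qed.

Lemma determinant_unit (d : 'rV[k]_n -> k) (x : 'rV[k]_n) :
    d one = 1 -> (forall x y, M x -> M y -> d (x ** y) = d x * d y) ->
  unit_group x -> d x != 0.
Proof.
move=> d1 dM [Mx [y My [xy _]]]; apply/negP => /eqP dx0.
by have /eqP := dM _ _ Mx My; rewrite xy d1 dx0 mul0r oner_eq0.
Qed.

(* M embeds in a matrix monoid; the inverse matrix of an element of M is again
   in M, by [vanish_invmx]. *)
Lemma exists_determinant : exists d, @monoid_determinant k M d.
Proof.
have [I [m [c [rm xm]]]] := mul_expand (fun j => regular_coord M j).
have [r [tau [w [[rtau tau1 tauM] [rw wM] span _]]]] :=
  translation_representation rm.
have M1 := mone_points M.
have /fin_all_exists [L xL] (j : 'I_n) : exists v : 'rV[k]_r,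
    forall x, M x -> x ord0 j = (v *m w x) ord0 ord0.
  apply: span => a Ma; exists (fun i => c j i a) => x Mx; exact: xm.
pose Lam : 'M[k]_(n, r) := \matrix_(j, i) L j ord0 i.
have xLam x : M x -> x = (Lam *m w x)^T.
  move=> Mx; apply/rowP=> j; rewrite xL // !mxE.
  by apply: eq_bigr => i _; rewrite !mxE.
have w_inj x y : M x -> M y -> w x = w y -> x = y.
  by move=> Mx My wxy; rewrite (xLam x Mx) wxy -xLam.
pose d x := \det (tau x).
have d1 : d one = 1 by rewrite /d tau1 det1.
have dM x y : M x -> M y -> d (x ** y) = d x * d y.
  by move=> Mx My; rewrite /d tauM // det_mulmx.
exists d; split=> // [|a Ma]; first exact: regular_det.
split=> [d0 /(determinant_unit d1 dM)|nunit]; first by rewrite d0 eqxx.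
apply/eqP/negPn/negP => dN0; apply: nunit.
have Tu : tau a \in unitmx by rewrite unitmxE unitfE.
pose X y := exists2 x, M x & y = w x.
have TX y : X y -> X (tau a *m y).
  by case=> x Mx ->; exists (a ** x); rewrite ?wM //; apply: mmul_points.
(* The value that [w] must take at an inverse of [a]. It satisfies all polynomial equations of the
   image of [w], so it comes from a point [b] of [M], recovered through [Lam]. *)
pose z := invmx (tau a) *m w one.
have vanish (q : {mpoly k[r]}) :
    (forall x, M x -> q.@[(w x)^~ ord0] = 0) -> q.@[z^~ ord0] = 0.
  move=> qw; apply: (vanish_invmx Tu TX) => [y [x Mx ->]|]; first exact: qw.
  by exists one.
pose b := (Lam *m z)^T.
have bE (p : {mpoly k[n]}) : (linear_subst Lam p).@[z^~ ord0] = p.@[b ord0].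
  by rewrite meval_linear_subst; apply: meval_eq => i; rewrite [RHS]mxE.
have wE (p : {mpoly k[n]}) x : M x ->
    (linear_subst Lam p).@[(w x)^~ ord0] = p.@[x ord0].
  move=> Mx; rewrite meval_linear_subst [in RHS](xLam x Mx).
  by apply: meval_eq => i; rewrite [RHS]mxE.
have Mb : M b.
  have [S MS] := points_closed M; apply/MS => p Sp; rewrite -bE.
  by apply: vanish => x Mx; rewrite wE //; move/MS: Mx; apply.
have wb : w b = z.
  apply/colP=> i; have [W wW] := rw i; rewrite wW // -bE.
  apply/eqP; rewrite -subr_eq0 -(mevalXU (fun i => z i ord0)) -mevalB.
  by apply/eqP/vanish => x Mx; rewrite mevalB wE // mevalXU wW // subrr.
have ab : a ** b = one.
  by apply: w_inj; rewrite ?wM ?wb ?mulKVmx //; apply: mmul_points.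
split=> //; exists b => //; split=> //.
have Mba := mmul_points Mb Ma; apply: w_inj => //.
rewrite -[b ** a]mmulx1 // wM // tauM // (mulmx1C (_ : tau a *m tau b = 1%:M)).
  by rewrite mul1mx.
by rewrite -tauM // ab.
Qed.

End Monoid.

(** * A determinant trivial on a closed normal subgroup *)

Theorem mainTheorem5 (k : closedFieldType) (M : affineMonoid k)
    (M_irr : irreducible_variety M) (H : 'rV[k]_(mdim M) -> Prop)
    (H_normal : normal_subgroup H) (H_closed : closed_in M H) :
  exists chi : 'rV[k]_(mdim M) -> k,
    monoid_determinant chi /\ (forall h, H h -> chi h = 1).
Proof.
have [HU H1 HM _ HJ] := H_normal.
have HMp h : H h -> M h by case/HU.
have M1 := mone_points M.
have [d [rd d1 dM d0]] := exists_determinant M.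
have dU x : unit_group x -> d x != 0 by apply: determinant_unit.
have [u ud] : exists u : {mpoly k[mdim M]},
    forall h, H h -> u.@[h ord0] * d h = 1.
  (* If the ideal [J] were proper, it would have a zero [v]. As [J] contains the equations of [H],
     [v] lies in [H]; but [J] also contains a polynomial equal to [d] on [M], and [d] has no zero on
     [H]. *)
  pose J (p : {mpoly k[mdim M]}) := exists u : {mpoly k[mdim M]},
    forall h, H h -> p.@[h ord0] = u.@[h ord0] * d h.
  apply: NNPP => nu.
  have J0 : J 0 by exists 0 => h _; rewrite !meval0 mul0r.
  have Jvan p : (forall h, H h -> p.@[h ord0] = 0) -> J p.
    by move=> p0; exists 0 => h Hh; rewrite p0 // meval0 mul0r.
  have [||[v vE]|a Ja] := weak_nullstellensatz J0.
  - move=> p q [v vE] [v' vE']; exists (v + v') => h Hh.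
    by rewrite !mevalD vE // vE' // mulrDl.
  - move=> p q [v vE]; exists (p * v) => h Hh.
    by rewrite !mevalM vE // mulrA.
  - by apply: nu; exists v => h Hh; rewrite -vE // meval1.
  pose v : 'rV[k]_(mdim M) := \row_i a i.
  have Jv p : J p -> p.@[v ord0] = 0.
    by move=> /Ja <-; apply: meval_eq => i; rewrite mxE.
  have [A [S AS] HA] := H_closed; have [S' MS] := points_closed M.
  have Mv : M v.
    apply/MS => p Sp; apply/Jv/Jvan => h /HMp /MS; exact.
  have Hv : H v.
    apply/HA; split=> //; apply/AS => p Sp; apply/Jv/Jvan => h /HA [_ /AS].
    exact.
  have [D dD] := rd.
  have /negP[] := dU _ (HU _ Hv); rewrite dD //; apply/eqP/Jv.
  by exists 1 => h /HMp Mh; rewrite meval1 mul1r dD.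
pose f (x : 'rV[k]_(mdim M)) := u.@[x ord0] * d x.
have [|I [m [c [rm um]]]] :=
    @mul_expand k M 1 (fun _ (x : 'rV[k]_(mdim M)) => u.@[x ord0]).
  by move=> _; exists u.
(* The factor [d] makes nonunits act by 0, and the translates of [f] stay in the span since [d] is
   multiplicative. *)
have rm' i : regular_function M (fun x => m i x * d x) by apply: regularM.
have [r [tau [w [[rtau tau1 tauM] [rw wM] span tau0]]]] :=
  translation_representation rm'.
have [v0 fv0] : exists v : 'rV[k]_r,
    forall x, M x -> f x = (v *m w x) ord0 ord0.
  apply: span => a Ma; exists (fun i => c ord0 i a * d a) => x Mx.
  rewrite /f (um ord0) // dM // mulr_suml; apply: eq_bigr => i _.
  by rewrite mulrACA.
have fH h : H h -> f h = 1 by apply: ud.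
have tauN x : M x -> ~ unit_group x -> tau x = 0.
  move=> Mx /(d0 _ Mx) dx; apply: tau0 => // i y My.
  by rewrite dM // dx mul0r mulr0.
have [||N NP] := @subspace_mx k r
  (fun v => forall h, H h -> (v *m w h) ord0 ord0 = 0).
- by move=> h _; rewrite mul0mx mxE.
- move=> a v v' vH v'H h Hh.
  by rewrite mulmxDl -scalemxAl mxE [X in _ + X]mxE vH // v'H // mulr0 addr0.
pose Gs g := exists2 x, unit_group x & g = tau x.
pose Hs g := exists2 x, H x & g = tau x.
have tauV x y : M x -> M y -> inverse_of x y -> tau x *m tau y = 1%:M.
  by move=> Mx My [xy _]; rewrite -tauM // xy.
have tau_inv x y : M x -> M y -> inverse_of x y -> invmx (tau x) = tau y.
  move=> Mx My xy; have xy1 := tauV _ _ Mx My xy.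
  have [xu _] := mulmx1_unit xy1.
  by rewrite -[RHS](mulKmx xu) xy1 mulmx1.
have [A [B [sA sB BA nAB trivAB]]] : exists A B : 'M[k]_r,
    [/\ stable Gs A, stable Gs B, (B <= A)%MS, ~~ (A <= B)%MS
      & forall h, Hs h -> (A *m h - A <= B)%MS].
  (* [N] encodes the functions vanishing on [H]. The vector [v0] of [f] is outside [N] because [f]
     is 1 at the neutral element, and fixed modulo [N] because [f] is constant on [H]. *)
  apply: (@trivial_subquotient k r Gs Hs _ _ _ _ _ _ N v0).
  - exists (mone M); rewrite ?tau1 //; split=> //.
    by exists (mone M); rewrite /inverse_of ?mmul1x.
  - move=> g [x [Mx [y My xy]] ->].
    by have [] := mulmx1_unit (tauV _ _ Mx My xy).
  - move=> g [x [Mx [y My xy]] ->]; rewrite (tau_inv x y) //.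
    by exists y => //; split=> //; exists x; case: xy.
  - move=> g h [x [Mx [x' Mx' [xx' x'x]]] ->] [y [My [y' My' [yy' y'y]]] ->].
    exists (mmul x y); rewrite ?tauM //; split; first exact: mmul_points.
    exists (mmul y' x'); first exact: mmul_points.
    have Mxy := mmul_points Mx My; have Myx' := mmul_points My' Mx'.
    split.
      by rewrite mmulA // -(mmulA Mx My My') yy' mmulx1.
    by rewrite mmulA // -(mmulA My' Mx' Mx) x'x mmulx1.
  - by move=> h [x Hx ->]; exists x => //; apply: HU.
  - move=> g h [x [Mx [y My xy]] ->] [z Hz ->]; rewrite (tau_inv x y) //.
    have Mz := HMp _ Hz.
    exists (mmul (mmul x z) y); first exact: HJ.
    by rewrite !tauM //; apply: mmul_points.
  - move=> g [h Hh ->]; apply/row_subP=> i; rewrite row_mul; apply/NP => h' Hh'.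
    rewrite -mulmxA -wM; [|exact: HMp|exact: HMp].
    by move/NP: (row_sub i N); apply; apply: HM.
  - by apply/negP => /NP /(_ _ H1) /eqP; rewrite -fv0 // fH // oner_eq0.
  move=> g [h Hh ->]; apply/NP => h' Hh'.
  have [Mh Mh'] := (HMp _ Hh, HMp _ Hh').
  rewrite mulmxBl -mulmxA -wM // mxE [X in _ + X]mxE -!fv0 //.
    by rewrite !fH ?subrr //; apply: HM.
  exact: mmul_points.
have [s [e [P [s_gt0 eA eP BP AP]]]] := quotient_block nAB.
pose theta x := e *m tau x *m P.
have stableM C x : stable Gs C -> M x -> (C *m tau x <= C)%MS.
  move=> sC Mx; have [Ux|nUx] := classic (unit_group x).
    by apply: sC; exists x.
  by rewrite tauN // mulmx0 sub0mx.
have thetaM x y : M x -> M y -> theta (mmul x y) = theta x *m theta y.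
  move=> Mx My; have etA : (e *m tau x <= A)%MS.
    by apply: submx_trans (stableM A x sA Mx); apply: submxMr.
  (* Modulo [B], [e *m tau x] is [theta x *m e]; the remainder stays in [B] under [tau y] and is
     killed by [P]. *)
  have /AP := etA; rewrite -/(theta x).
  move: (e *m tau x - _) (addrNK (theta x *m e) (e *m tau x)) => b eb bB.
  have bP : b *m tau y *m P = 0.
    by apply: BP; apply: submx_trans (stableM B y sB My); apply: submxMr.
  by rewrite {1}/theta tauM // mulmxA -eb !mulmxDl bP add0r /theta !mulmxA.
have theta1 : theta (mone M) = 1%:M by rewrite /theta tau1 mulmx1 eP.
exists (fun x => \det (theta x)); split; last first.
  move=> h Hh; rewrite (_ : theta h = 1%:M) ?det1 //.
  apply/eqP; rewrite -subr_eq0 -eP -mulmxBl; apply/eqP/BP.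
  have [X ->] := submxP eA; rewrite -mulmxA -mulmxBr.
  by apply: mulmx_sub; apply: trivAB; exists h.
split.
- apply: regular_det => i j; apply: regular_mulmx => [i' j'|i' j'].
    by apply: regular_mulmx => [i2 j2|i2 j2]; first exact: regular_const.
  exact: regular_const.
- by rewrite theta1 det1.
- by move=> x y Mx My; rewrite thetaM // det_mulmx.
move=> x Mx; split=> [dx Ux|nUx].
  have [y My xy] := Ux.2; have := thetaM x y Mx My.
  case: xy => -> _ /(congr1 determinant) /eqP.
  by rewrite theta1 det1 det_mulmx dx mul0r oner_eq0.
rewrite /theta tauN // mulmx0 mul0mx.
(* A zero matrix has determinant 0 only in positive size, which is why [A/B] must be nonzero. *)
by case: (s) s_gt0 => // s' _; rewrite det0.
Qed.
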